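(* Let $G$ be a strongly connected digraph with $n$ vertices and at least one edge. For any $u\in V(G)$ and any biclique partition $\varepsilon=\{Q_1,\ldots,Q_r\}$ of $G$, we have $$\pi_u(G)=\sum_{i:\,u\in Q_i^{(2)}}|Q_i^{(2)}|^{-1}\,\pi_{Q_i}(\Theta(\varepsilon)),$$ $$\mathcal{K}(G)=\mathcal{K}(\Theta(\varepsilon))+n-r,$$ where $\Theta(\varepsilon)$ is the weighted biclique digraph of $\varepsilon$ defined in the context.
   Context: A digraph $G$ has a finite vertex set $V(G)$ and an edge set $E(G)$ of ordered pairs; $ij\in E(G)$ means there is a directed edge from tail $i$ to head $j$. $d_u^+(G)$ denotes the outdegree of $u$. In a weighted digraph each edge $ij$ carries a weight $w_{ij}(G)$, and $d_i(G)=\sum_{ij\in E(G)}w_{ij}(G)$; an unweighted digraph is regarded as weighted with all weights equal to $1$. For a strongly connected weighted digraph $G$ with positive weights, the transition probability matrix $P_G$ has entries $(P_G)_{ij}=w_{ij}(G)/d_i(G)$ if $ij\in E(G)$ and $0$ otherwise; it defines the random walk on $G$. The stationary distribution vector $\pi(G)=(\pi_i(G))_{i\in V(G)}$ is the unique positive vector with $\pi(G)^\top P_G=\pi(G)^\top$ and $\sum_i\pi_i(G)=1$. If $m_{ij}$ denotes the mean first passage time from vertex $i$ to vertex $j$ of this random walk, then $\mathcal{K}(G)=\sum_{j\in V(G),\,j\neq i}m_{ij}\pi_j(G)$, which does not depend on $i$, is Kemeny's constant of $G$. A biclique is a bipartite digraph $Q$ whose vertices are partitioned into two (nonempty, disjoint)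 parts $Q^{(1)},Q^{(2)}$ with $E(Q)=\{ij:i\in Q^{(1)},j\in Q^{(2)}\}$. A biclique partition of $G$ is a set $\varepsilon=\{Q_1,\ldots,Q_r\}$ of bicliques in $G$ (subdigraphs of $G$) such that each edge of $G$ belongs to exactly one biclique of $\varepsilon$. $\Theta(\varepsilon)$ is the weighted digraph with vertex set $\{Q_1,\ldots,Q_r\}$ and edge set $\{Q_iQ_j:Q_i^{(2)}\cap Q_j^{(1)}\neq\emptyset\}$, where the edge $Q_iQ_j$ has weight $$w_{Q_iQ_j}(\Theta(\varepsilon))=|Q_j^{(2)}|\sum_{u\in Q_i^{(2)}\cap Q_j^{(1)}}\frac{1}{d_u^+(G)}.$$ *)

(* Defs.v *)
From HB Require Import structures.
From mathcomp Require Import all_boot all_order all_algebra.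
From mathcomp Require Import all_classical all_reals all_analysis.

Set Implicit Arguments.
Unset Strict Implicit.
Unset Printing Implicit Defensive.

Import Order.TTheory GRing.Theory Num.Theory.
Local Open Scope ring_scope.

(* The values [weight i j] with [~~ edge i j] are never used. *)
Record wdigraph (R : realType) := WDigraph {
  vertex :> finType;
  edge : rel vertex;
  weight : vertex -> vertex -> R }.

Definition unweighted (R : realType) (V : finType) (E : rel V) : wdigraph R :=
  @WDigraph R V E (fun _ _ => 1).

Definition strongly_connected (V : finType) (E : rel V) : Prop :=
  forall x y, connect E x y.

Definition outdeg (V : finType) (E : rel V) (u : V) : nat := #|[set v | E u v]|.

Section RandomWalk.
Variables (R : realType) (G : wdigraph R).

Definition wdeg (i : G) : R := \sum_(j | edge i j) weight i j.

Definition trans_prob (i j : G) : R :=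
  if edge i j then weight i j / wdeg i else 0.

Definition is_stationary (p : {ffun G -> R}) : Prop :=
  [/\ forall j, 0 < p j,
      forall j, \sum_i p i * trans_prob i j = p j
    & \sum_i p i = 1].

(* Definite description: when [G] is strongly connected with positive weights,
   exactly one vector satisfies [is_stationary]. *)
Definition stationary : {ffun G -> R} :=
  xget [ffun=> 0] [set p | is_stationary p]%classic.

(* Probability that the walk started at [i] has (X_1, ..., X_t) = s,
   where t = size s. *)
Definition walk_prob (i : G) (s : seq G) : R :=
  \prod_(e <- zip (i :: s) s) trans_prob e.1 e.2.

(* Probability that min {t >= 1 | X_t = j} equals [t] when X_0 = i: the index
   condition says that [j] occurs in (X_1, ..., X_t) for the first time at the
   last position. *)
Definition first_passage_prob (i j : G) (t : nat) : R :=
  \sum_(s : t.-tuple G | (index j s).+1 == t) walk_prob i s.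

(* Expectation of the first passage time. The event that [j] is never reached
   does not contribute; it has probability 0 when [G] is strongly connected
   with positive weights. *)
Definition mean_first_passage (i j : G) : \bar R :=
  (\sum_(0 <= t <oo) (t%:R * first_passage_prob i j t)%:E)%E.

(* Kemeny's constant computed from the starting vertex [i], on which its value
   does not depend when [G] is strongly connected with positive weights. *)
Definition kemeny (i : G) : \bar R :=
  (\sum_(j | j != i) mean_first_passage i j * (stationary j)%:E)%E.

End RandomWalk.

(* A biclique is encoded by its ordered pair of parts (Q.1, Q.2); both parts
   being nonempty, they are determined by the edge set Q.1 x Q.2. *)
Definition is_biclique (V : finType) (Q : {set V} * {set V}) : Prop :=
  [/\ Q.1 != finset.set0, Q.2 != finset.set0 & [disjoint Q.1 & Q.2]].

Definition biclique_in (V : finType) (E : rel V) (Q : {set V} * {set V}) : Prop :=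
  is_biclique Q /\ forall i j, i \in Q.1 -> j \in Q.2 -> E i j.

Definition biclique_partition (V : finType) (E : rel V)
    (eps : {set {set V} * {set V}}) : Prop :=
  (forall Q, Q \in eps -> biclique_in E Q) /\
  (forall i j, E i j -> exists! Q, [/\ Q \in eps, i \in Q.1 & j \in Q.2]).

Definition biclique_digraph (R : realType) (V : finType) (E : rel V)
    (eps : {set {set V} * {set V}}) : wdigraph R :=
  @WDigraph R {Q | Q \in eps}
    (fun Qi Qj => (val Qi).2 :&: (val Qj).1 != finset.set0)
    (fun Qi Qj => #|(val Qj).2|%:R *
       \sum_(u in (val Qi).2 :&: (val Qj).1) (outdeg E u)%:R^-1).

(* Main.v *)
(* One step of the walk on G is the composition of two stochastic kernels: U
   from vertices to bicliques (choose the biclique of the next edge) and W from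
   bicliques to vertices (choose a uniform vertex of the second part).  Thus
   P_G = U W, while P_Theta = W U, and pi_G = pi_Theta W by uniqueness of the
   stationary vector.
   For an irreducible chain, Kemeny's constant is tr Z - 1 with
   Z = (I - P + 1 pi)^-1.  As I - P_G + 1 pi_G = I - (U - 1 pi_Theta) W and
   I - P_Theta + 1 pi_Theta = I - W (U - 1 pi_Theta), the identity
   (I - M N)^-1 = I + M (I - N M)^-1 N gives tr Z_G - tr Z_Theta = n - r. *)

Require Import Defs.
From HB Require Import structures.
From mathcomp Require Import all_boot all_order all_algebra.
From mathcomp Require Import all_classical all_reals all_analysis.
From mathcomp Require Import ring lra.

Set Implicit Arguments.
Unset Strict Implicit.
Unset Printing Implicit Defensive.

Import Order.TTheory GRing.Theory Num.Theory.
Import numFieldNormedType.Exports.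
Local Open Scope ring_scope.

(** * A limit, and sums over tuples and finite types *)

(** With [s] the square root of [x], one factor [s ^+ n] absorbs [n] and the other still decays
    geometrically. *)
Lemma cvg_natmul_expr (R : realType) (x : R) : 0 <= x -> x < 1 ->
  (n%:R * x ^+ n @[n --> \oo] --> (0 : R))%classic.
Proof.
move=> x0 x1; set s := Num.sqrt x.
have s0 : 0 <= s by exact: sqrtr_ge0.
have s1 : s < 1 by rewrite -sqrtr1 ltr_sqrt.
(* Each of the [n] terms of 1 + s + ... + s^(n-1) is at least s^n. *)
have bound n : n%:R * (1 - s) * s ^+ n <= 1 - s ^+ n.
  elim: n => [|n IH]; first by rewrite !mul0r expr0 subrr.
  have sn0 : 0 <= s ^+ n by rewrite exprn_ge0.
  have sn1 : s ^+ n <= 1 by rewrite exprn_ile1 // ltW.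
  have := ler_wpM2l s0 IH; rewrite -(addn1 n) natrD exprD expr1.
  have h : 0 <= (1 - s) * (1 - s ^+ n * s).
    by rewrite mulr_ge0 // subr_ge0 ?(ltW s1) // mulr_ile1 // ltW.
  nra.
have lim0 : ((1 - s)^-1 * s ^+ n @[n --> \oo] --> (0 : R))%classic.
  by apply: cvg_geometric; rewrite ger0_norm.
apply: (squeeze_cvgr _ (cvg_cst (0 : R)) lim0).
apply: nearW => n; apply/andP; split.
  by rewrite mulr_ge0 // exprn_ge0.
have -> : x = s * s by rewrite -expr2 sqr_sqrtr.
rewrite exprMn mulrA ler_wpM2r ?exprn_ge0 //.
rewrite -[leRHS]mulr1 ler_pdivlMl ?subr_gt0 //.
rewrite mulrA [_ * n%:R]mulrC; apply: (le_trans (bound n)).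
by rewrite gerBl exprn_ge0.
Qed.

(** Separating the head of a tuple is what conditioning a walk on its first step amounts to. *)
Lemma big_cons_tuple (R : Type) (idx : R) (op : Monoid.com_law idx)
    (T : finType) n (P : pred (seq T)) (F : seq T -> R) :
  \big[op/idx]_(s : n.+1.-tuple T | P s) F s =
  \big[op/idx]_(k : T) \big[op/idx]_(s : n.-tuple T | P (k :: s)) F (k :: s).
Proof.
rewrite pair_big_dep /=.
rewrite (reindex (fun p : T * n.-tuple T => [tuple of p.1 :: p.2])) /=.
  by apply: eq_big => -[].
exists (fun s : n.+1.-tuple T => (thead s, [tuple of behead s])).
  by move=> [x s] _ /=; rewrite theadE; congr (_, _); apply: val_inj.
by move=> s _; rewrite [RHS]tuple_eta.
Qed.

Lemma big_enum_ord (R : Type) (idx : R) (op : Monoid.com_law idx) (T : finType)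
    (F : T -> R) :
  \big[op/idx]_(i < #|T|) F (enum_val i) = \big[op/idx]_i F i.
Proof. by rewrite -big_enum_val; apply: eq_bigl => i; rewrite inE. Qed.

(** * Functions on finite types as matrices *)

Definition fun_mx (R : Type) (S T : finType) (A : S -> T -> R) :
    'M[R]_(#|S|, #|T|) :=
  \matrix_(i, j) A (enum_val i) (enum_val j).

Lemma fun_mx_mul (R : pzRingType) (S T U : finType) (A : S -> T -> R)
    (B : T -> U -> R) :
  fun_mx A *m fun_mx B = fun_mx (fun i k => \sum_j A i j * B j k).
Proof.
apply/matrixP => i k; rewrite !mxE -[RHS]big_enum_ord.
by apply: eq_bigr => j _; rewrite !mxE.
Qed.

Lemma eq_fun_mx (R : Type) (S T : finType) (A B : S -> T -> R) :
  A =2 B -> fun_mx A = fun_mx B.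
Proof. by move=> AB; apply/matrixP => i j; rewrite !mxE. Qed.

Definition fun_row (R : Type) (T : finType) (p : T -> R) : 'rV[R]_#|T| :=
  \row_j p (enum_val j).

Lemma fun_row_mul (R : pzRingType) (S T : finType) (p : S -> R) (A : S -> T -> R) :
  fun_row p *m fun_mx A = fun_row (fun j => \sum_i p i * A i j).
Proof.
apply/rowP => k; rewrite !mxE -[RHS]big_enum_ord.
by apply: eq_bigr => j _; rewrite !mxE.
Qed.

Lemma fun_row_const1 (R : pzRingType) (T : finType) (p : T -> R) :
  fun_row p *m const_mx 1 = (\sum_i p i)%:M.
Proof.
apply/rowP => k; rewrite !mxE ord1 eqxx mulr1n -[RHS]big_enum_ord.
by apply: eq_bigr => j _; rewrite !mxE mulr1.
Qed.

Lemma fun_mx_const1 (R : pzRingType) (S T : finType) (A : S -> T -> R) :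
  (forall i, \sum_j A i j = 1) -> fun_mx A *m const_mx 1 = const_mx 1 :> 'cV_ _.
Proof.
move=> A1; apply/colP => k; rewrite !mxE; apply: etrans (A1 (enum_val k)).
rewrite -[RHS]big_enum_ord.
by apply: eq_bigr => j _; rewrite !mxE mulr1.
Qed.

(** A square system with trivial kernel is solvable; this yields mean hitting times without summing
    a series. *)
Lemma injective_solvable (F : fieldType) (T : finType) (A : T -> T -> F) :
  (forall x : T -> F, (forall i, \sum_k A i k * x k = 0) -> forall i, x i = 0) ->
  forall b, exists x : T -> F, forall i, \sum_k A i k * x k = b i.
Proof.
move=> injA b.
have uA : fun_mx A \in unitmx.
  (* [kermx] is a left kernel, whereas [injA] concerns the right one; hence the transpose. *)
  rewrite -unitmx_tr -row_free_unit -kermx_eq0.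
  apply/rowV0P => v /sub_kermxP vA; apply/rowP => i; rewrite mxE.
  rewrite -(enum_valK i); apply: (injA (fun t => v 0 (enum_rank t))) => {}i.
  have := congr1 (fun M : 'rV_ _ => M 0 (enum_rank i)) vA.
  rewrite !mxE; apply: etrans; rewrite -[LHS]big_enum_ord; apply: eq_bigr => k _.
  by rewrite !mxE enum_rankK enum_valK mulrC.
pose b' : 'cV[F]_#|T| := \col_i b (enum_val i).
exists (fun t => (invmx (fun_mx A) *m b') (enum_rank t) 0) => i.
have := congr1 (fun M : 'cV_ _ => M (enum_rank i) 0) (mulKVmx uA b').
rewrite [RHS]mxE enum_rankK => <-; rewrite [RHS]mxE -[LHS]big_enum_ord.
by apply: eq_bigr => k _; rewrite !mxE enum_rankK enum_valK.
Qed.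

(** A singular square matrix has nonzero kernels on both sides. Applied to I - P, which kills
    constants, it produces an invariant row vector. *)
Lemma left_kernel_of_right_kernel (F : fieldType) (T : finType)
    (A : T -> T -> F) (x : T -> F) i0 :
  (forall i, \sum_k A i k * x k = 0) -> x i0 != 0 ->
  exists y : T -> F, (exists i, y i != 0) /\
    forall j, \sum_i y i * A i j = 0.
Proof.
move=> Ax0 xi0.
pose c : 'cV[F]_#|T| := \col_i x (enum_val i).
have Ac : fun_mx A *m c = 0.
  apply/colP => i; rewrite !mxE; apply: etrans (Ax0 (enum_val i)).
  rewrite -[RHS]big_enum_ord.
  by apply: eq_bigr => k _; rewrite !mxE.
have nuA : kermx (fun_mx A) != 0.
  rewrite kermx_eq0 row_free_unit; apply: contra xi0 => uA.
  have := congr1 (fun M : 'cV_ _ => M (enum_rank i0) 0) (mulKmx uA c).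
  by rewrite Ac mulmx0 !mxE enum_rankK => <-.
have /rowV0Pn[v /sub_kermxP vA v0] := nuA.
exists (fun t => v 0 (enum_rank t)); split.
  by have /rV0Pn[i vi] := v0; exists (enum_val i); rewrite enum_valK.
move=> j; have := congr1 (fun M : 'rV_ _ => M 0 (enum_rank j)) vA.
rewrite !mxE; apply: etrans; rewrite -[LHS]big_enum_ord.
by apply: eq_bigr => k _; rewrite !mxE enum_rankK enum_valK.
Qed.

(** * Irreducible chains: hitting equations and invariant vectors *)

Section IrreducibleChain.
Variables (R : realType) (T : finType) (P : T -> T -> R).
Hypothesis P_ge0 : forall i j, 0 <= P i j.
Hypothesis P_sum1 : forall i, \sum_j P i j = 1.
Hypothesis P_irr : forall i j, connect (fun x y => 0 < P x y) i j.

(** The transition operator killed on entering [j]. Its [t]-th iterate on the constant 1 is the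
    probability of not meeting [j] at times 1, ..., t, so a start at [j] is allowed. *)
Definition avoid j (f : T -> R) i := \sum_(k | k != j) P i k * f k.

(** Minimum principle: from a negative minimum, all transitions lead to minimizers other than [j],
    so [j] is never reached, against irreducibility. *)
Lemma avoid_superharmonic_ge0 j f :
  (forall i, avoid j f i <= f i) -> forall i, 0 <= f i.
Proof.
move=> sup i1; case: (arg_minP f (erefl : predT i1)) => i0 _ fmin.
apply: (le_trans _ (fmin i1 erefl)); rewrite leNgt; apply/negP => fi0.
(* The minimizers of [f] form a set closed under transitions that avoid [j]. *)
have closed x : f x = f i0 -> forall k, 0 < P x k -> k != j /\ f k = f i0.
  move=> fx k Pk.
  (* With [f] replaced by 0 at [j], the mean excess over the minimum is a sum of nonnegative terms
     that is at most 0, so every term vanishes. *)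
  pose g y := P x y * ((if y == j then 0 else f y) - f i0).
  have g0 y : true -> 0 <= g y.
    move=> _; rewrite mulr_ge0 // subr_ge0.
    by case: eqP => // _; [exact: ltW|exact: fmin].
  have sg : \sum_y g y = 0.
    apply/eqP; rewrite eq_le sumr_ge0 // andbT.
    under eq_bigr do rewrite /g mulrBr.
    rewrite big_split /= sumrN -mulr_suml P_sum1 mul1r subr_le0.
    apply: le_trans (_ : avoid j f x <= _); last by rewrite -fx.
    rewrite /avoid [X in _ <= X]big_mkcond /=; apply: ler_sum => y _.
    by case: eqP; rewrite ?mulr0.
  have /eqP := psumr_eq0P g0 sg (i := k) erefl.
  rewrite mulf_eq0 gt_eqF //= subr_eq0.
  have [_ /eqP h|_ /eqP //] := eqVneq k j.
  by rewrite -h ltxx in fi0.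
have avoids p : forall x, f x = f i0 -> x != j ->
    path (fun x y => 0 < P x y) x p -> last x p != j.
  elim: p => [//|k p IH] x fx xj /= /andP[Pxk].
  by have [kj fk] := closed x fx k Pxk; apply: IH.
(* A first step is taken separately because [i0] may be [j], where [avoids] does not apply. *)
have [k Pk] : exists k, 0 < P i0 k.
  apply/existsP; apply: contraT; rewrite negb_exists => /forallP h.
  have := P_sum1 i0; rewrite big1 => [/eqP|k _]; first by rewrite eq_sym oner_eq0.
  by apply/eqP; rewrite eq_le P_ge0 andbT leNgt.
have [kj fk] := closed i0 erefl k Pk.
have /connectP[p pth lst] := P_irr k j.
by have := avoids p k fk kj pth; rewrite -lst eqxx.
Qed.

Lemma avoidB j f g i : avoid j (fun x => f x - g x) i = avoid j f i - avoid j g i.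
Proof. by rewrite /avoid -sumrB; apply: eq_bigr => k _; rewrite mulrBr. Qed.

Lemma avoidD j f g i : avoid j (fun x => f x + g x) i = avoid j f i + avoid j g i.
Proof. by rewrite /avoid -big_split; apply: eq_bigr => k _; rewrite mulrDr. Qed.

Lemma avoidZ j a f i : avoid j (fun x => a * f x) i = a * avoid j f i.
Proof. by rewrite /avoid mulr_sumr; apply: eq_bigr => k _; rewrite mulrCA. Qed.

Lemma ler_avoid j f g i : (forall k, f k <= g k) -> avoid j f i <= avoid j g i.
Proof. by move=> fg; apply: ler_sum => k _; rewrite ler_wpM2l. Qed.

Lemma eq_avoid j f g i : f =1 g -> avoid j f i = avoid j g i.
Proof. by move=> fg; apply: eq_bigr => k _; rewrite fg. Qed.

Lemma avoid_harmonic_eq0 j f : (forall i, avoid j f i = f i) -> forall i, f i = 0.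
Proof.
move=> har i; apply/eqP; rewrite eq_le (@avoid_superharmonic_ge0 j f) => [|k].
  rewrite andbT -oppr_ge0 (@avoid_superharmonic_ge0 j (fun x => - f x)) // => k.
  under eq_avoid do rewrite -mulN1r.
  by rewrite avoidZ mulN1r har.
by rewrite har.
Qed.

(** The system is I minus P with column [j] cleared, injective by [avoid_harmonic_eq0]. The value
    [h j] is a mean return time. *)
Lemma ex_mean_hitting j :
  exists h : T -> R, forall i, h i = 1 + avoid j h i.
Proof.
pose A i k := (i == k)%:R - (if k == j then 0 else P i k).
have AE x i : \sum_k A i k * x k = x i - avoid j x i.
  under eq_bigr do rewrite /A mulrBl.
  rewrite sumrB; congr (_ - _).
    rewrite (bigD1 i) //= eqxx mul1r big1 ?addr0 // => k ki.
    by rewrite eq_sym (negPf ki) mul0r.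
  rewrite /avoid [RHS]big_mkcond /=; apply: eq_bigr => k _.
  by case: eqP => //= _; rewrite mul0r.
have [x Ax|h hE] := @injective_solvable _ _ A _ (fun=> 1).
  by apply: (@avoid_harmonic_eq0 j) => i; apply/eqP; rewrite eq_sym -subr_eq0 -AE Ax.
by exists h => i; rewrite -(hE i) AE subrK.
Qed.

Definition invariant (p : T -> R) := forall j, \sum_i p i * P i j = p j.

(** Positivity at one state spreads along transitions of positive probability. *)
Lemma invariant_gt0 p : (forall i, 0 <= p i) -> invariant p ->
  (exists i, p i != 0) -> forall j, 0 < p j.
Proof.
move=> p0 inv [i pni] j; have /connectP[s pth ->] := P_irr i j.
have {pni} : 0 < p i by rewrite lt_def pni p0.
elim: s i pth => [//|k s IH] i /= /andP[Pik /IH h] pgt; apply: h.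
rewrite -(inv k) (bigD1 i) //= ltr_pwDl ?mulr_gt0 //.
by apply: sumr_ge0 => l _; rewrite mulr_ge0.
Qed.

Lemma ex_invariant : (exists i : T, true) ->
  exists p : T -> R,
    [/\ forall i, 0 < p i, invariant p & \sum_i p i = 1].
Proof.
move=> [i0 _].
have [||y [[i1 y1] yA]] := @left_kernel_of_right_kernel R T
    (fun i j => (i == j)%:R - P i j) (fun=> 1) i0.
- move=> i; under eq_bigr do rewrite mulr1; rewrite sumrB P_sum1.
  rewrite (bigD1 i) //= eqxx big1 ?addr0 ?subrr // => k ki.
  by rewrite eq_sym (negPf ki).
- exact: oner_neq0.
have yP : invariant y.
  move=> j; apply/esym/eqP; rewrite -subr_eq0; apply/eqP.
  apply: etrans (yA j); under [RHS]eq_bigr do rewrite mulrBr.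
  rewrite sumrB; congr (_ - _); rewrite (bigD1 j) //= eqxx mulr1 big1 ?addr0 //.
  by move=> k /negPf ->; rewrite mulr0.
(* By the triangle inequality [q] is at most its image under P, and the total masses agree, so [q]
   is invariant too. *)
pose q i := `|y i|.
have q0 i : 0 <= q i by exact: normr_ge0.
have qP : invariant q.
  have d0 j : true -> 0 <= \sum_i q i * P i j - q j.
    move=> _; rewrite subr_ge0 /q -(yP j); apply: le_trans (ler_norm_sum _ _ _) _.
    by apply: ler_sum => i _; rewrite normrM (ger0_norm (P_ge0 _ _)).
  have ds : \sum_j (\sum_i q i * P i j - q j) = 0.
    rewrite sumrB exchange_big /=.
    by under eq_bigr do rewrite -mulr_sumr P_sum1 mulr1; rewrite subrr.
  move=> j; apply/eqP; rewrite -subr_eq0; apply/eqP.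
  exact: (psumr_eq0P d0 ds).
have qpos : forall i, 0 < q i.
  by apply: invariant_gt0 => //; exists i1; rewrite normr_eq0.
have s0 : 0 < \sum_i q i.
  by rewrite (bigD1 i0) //= ltr_pwDl // sumr_ge0.
exists (fun i => (\sum_i q i)^-1 * q i); split.
- by move=> i; rewrite mulr_gt0 ?invr_gt0.
- by move=> j; rewrite -(qP j) mulr_sumr; apply: eq_bigr => i _; rewrite mulrA.
- by rewrite -mulr_sumr mulVf // gt_eqF.
Qed.

Lemma invariant_unique p q :
  (forall i, 0 < p i) -> invariant p -> \sum_i p i = 1 ->
  (forall i, 0 < q i) -> invariant q -> \sum_i q i = 1 -> p =1 q.
Proof.
move=> p0 pP p1 q0 qP q1 i1.
(* Subtract from [q] the largest multiple of [p] that leaves it nonnegative. *)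
case: (arg_minP (fun i => q i / p i) (erefl : predT i1)) => i0 _ cmin.
set c := q i0 / p i0 in cmin.
pose d i := q i - c * p i.
have d0 i : 0 <= d i by rewrite subr_ge0 -ler_pdivlMr // cmin.
have dP : invariant d.
  move=> j; under eq_bigr do rewrite mulrBl -mulrA.
  by rewrite sumrB -mulr_sumr pP qP.
have di0 : d i0 = 0 by rewrite /d /c divfK ?subrr // gt_eqF.
(* A nonzero [d] would be positive everywhere by [invariant_gt0], yet it vanishes at [i0]. *)
have dz i : d i = 0.
  apply/eqP; apply: contraT => di.
  by have := invariant_gt0 d0 dP (ex_intro _ i di) i0; rewrite di0 ltxx.
have qE i : q i = c * p i by apply/eqP; rewrite -subr_eq0; apply/eqP/dz.
have c1 : c = 1.
  by rewrite -q1 -[LHS]mulr1 -p1 mulr_sumr; apply: eq_bigr => i _; rewrite qE.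
by rewrite qE c1 mul1r.
Qed.

End IrreducibleChain.

(** * Two matrix identities about traces of inverses *)

(** Meant for [u] the all-ones column, [w] the stationary row and [X] the matrix of m_ij pi_j with
    zero diagonal. Then [X *m u] lists Kemeny's constant by starting vertex, and its being a
    multiple of [u] is the independence of the start. *)
Lemma fundamental_matrix_trace (R : comUnitRingType) n (P X : 'M[R]_n)
    (w : 'rV[R]_n) (u : 'cV[R]_n) :
  (1%:M - P) *m X = u *m w - 1%:M -> P *m u = u -> w *m u = 1%:M ->
  (forall i, X i i = 0) ->
  exists2 Z, (1%:M - P + u *m w) *m Z = 1%:M & X *m u = (\tr Z - 1) *: u.
Proof.
move=> XE Pu wu X0; set M := _ + _.
have MX : M *m X = u *m w - 1%:M + u *m (w *m X) by rewrite mulmxDl XE mulmxA.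
have Mu : M *m u = u.
  by rewrite !mulmxDl mulNmx mul1mx Pu subrr add0r -mulmxA wu mulmx1.
(* Multiplication by [M] fixes [u], so the last summand cancels the surplus term of [MX]. *)
pose Z := u *m w - X + u *m (w *m X).
have MZ : M *m Z = 1%:M.
  rewrite !mulmxDr mulmxN MX !mulmxA Mu -!mulmxA.
  by rewrite opprD opprB -addrA subrK addrC subrK.
exists Z => //.
have ZM := mulmx1C MZ.
have XuE : X *m u = u *m (w *m X *m u).
  have MXu : M *m (X *m u) = M *m (u *m (w *m X *m u)).
    rewrite mulmxA MX [RHS]mulmxA Mu !mulmxDl mulNmx mul1mx.
    by rewrite -[u *m w *m u]mulmxA wu mulmx1 subrr add0r -mulmxA.
  by rewrite -[LHS]mul1mx -ZM -[LHS]mulmxA MXu mulmxA ZM mul1mx.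
have trX : \tr X = 0 by apply: big1 => i _; exact: X0.
have trZ : \tr Z - 1 = \tr (w *m X *m u).
  rewrite !mxtraceD mxtrace_mulC wu mxtrace1 raddfN /= trX oppr0 addr0.
  by rewrite mxtrace_mulC addrC addKr.
rewrite trZ XuE; move: (w *m X *m u) => c.
by rewrite [c]mx11_scalar mul_mx_scalar mxtrace_scalar mulr1n.
Qed.

(** The trace of M Z N is that of Z N M = Z - I, which explains the difference of the two sizes. *)
Lemma mxtrace_inv_1B_mulC (R : comUnitRingType) m n (M : 'M[R]_(m, n))
    (N : 'M[R]_(n, m)) (Y : 'M[R]_m) (Z : 'M[R]_n) :
  (1%:M - M *m N) *m Y = 1%:M -> (1%:M - N *m M) *m Z = 1%:M ->
  \tr Y = \tr Z + m%:R - n%:R.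
Proof.
move=> MY NZ.
have YE : Y = 1%:M + M *m Z *m N.
  have /(congr1 (mulmx Y)) : (1%:M - M *m N) *m (1%:M + M *m Z *m N) = 1%:M.
    have push : (1%:M - M *m N) *m M = M *m (1%:M - N *m M).
      by rewrite mulmxBl mulmxBr mul1mx mulmx1 mulmxA.
    by rewrite mulmxDr mulmx1 !mulmxA push -[M *m _ *m Z]mulmxA NZ mulmx1 subrK.
  by rewrite mulmxA (mulmx1C MY) mul1mx mulmx1.
have ZE : Z *m N *m M = Z - 1%:M.
  have := mulmx1C NZ; rewrite mulmxBr mulmx1 mulmxA => <-.
  by rewrite opprB addrC subrK.
rewrite YE mxtraceD mxtrace1 -mulmxA mxtrace_mulC ZE raddfB /= mxtrace1.
by rewrite addrC -addrA [- _ + _]addrC addrA.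
Qed.

(** * Kemeny's constant as the trace of the fundamental matrix *)

Section KemenyTrace.
Variables (R : realType) (G : wdigraph R).
Notation P := (@trans_prob R G).
Hypothesis P_ge0 : forall i j, 0 <= P i j.
Hypothesis P_sum1 : forall i, \sum_j P i j = 1.
Hypothesis P_irr : forall i j, connect (fun x y => 0 < P x y) i j.

Lemma walk_prob_cons (i k : G) s : walk_prob i (k :: s) = P i k * walk_prob k s.
Proof. by rewrite /walk_prob /= big_cons. Qed.

Lemma first_passage_probSS (i j : G) t :
  first_passage_prob i j t.+2 = avoid P j (fun k => first_passage_prob k j t.+1) i.
Proof.
rewrite /first_passage_prob.
rewrite (@big_cons_tuple _ _ _ _ _ (fun s => (index j s).+1 == t.+2) (walk_prob i)).
rewrite /avoid [RHS]big_mkcond /=; apply: eq_bigr => k _.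
(* A first step to [j] puts its first occurrence at time 1, too early. *)
case: eqP => [->|_] /=; first by rewrite big_pred0.
by rewrite mulr_sumr; apply: eq_bigr => s _; rewrite walk_prob_cons.
Qed.

Lemma first_passage_prob1 (i j : G) : first_passage_prob i j 1%N = P i j.
Proof.
rewrite /first_passage_prob.
rewrite (@big_cons_tuple _ _ _ _ _ (fun s => (index j s).+1 == 1%N) (walk_prob i)).
rewrite (bigD1 j) //= [X in _ + X]big1 ?addr0 => [|k kj]; last first.
  by rewrite big_pred0 // => s; rewrite (negPf kj).
rewrite (bigD1 [tuple]) /= ?eqxx // [X in _ + X]big1 ?addr0 => [|s]; last first.
  by rewrite [s]tuple0 andbC => /negP[]; apply/eqP.
by rewrite walk_prob_cons /walk_prob big_nil mulr1.
Qed.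

(** First passage at time t + 1 means surviving t steps but not t + 1. *)
Lemma first_passage_probS (i j : G) t :
  first_passage_prob i j t.+1 =
  iter t (avoid P j) (fun=> 1) i - iter t.+1 (avoid P j) (fun=> 1) i.
Proof.
elim: t i => [|t IH] i.
  rewrite first_passage_prob1 /= /avoid -[X in X - _](P_sum1 i) (bigD1 j) //=.
  by under [X in _ - X]eq_bigr do rewrite mulr1; rewrite addrK.
by rewrite first_passage_probSS (eq_avoid _ _ _ IH) avoidB.
Qed.

Section MeanFirstPassage.
Variables (j : G) (h : G -> R).
Hypothesis hE : forall i, h i = 1 + avoid P j h i.

Lemma iter_avoid_hitting n i :
  iter n (avoid P j) h i =
  iter n (avoid P j) (fun=> 1) i + iter n.+1 (avoid P j) h i.
Proof.
elim: n i => [|n IH] i; first by rewrite /= hE.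
by rewrite iterS (eq_avoid _ _ _ IH) avoidD.
Qed.

(** Summation by parts over survival probabilities, whose partial sums telescope by
    [iter_avoid_hitting]. Both subtracted terms tend to 0. *)
Lemma partial_mean_first_passage n i :
  \sum_(0 <= t < n.+1) t%:R * first_passage_prob i j t =
  h i - iter n (avoid P j) h i - n%:R * iter n (avoid P j) (fun=> 1) i.
Proof.
elim: n => [|n IH]; first by rewrite big_nat1 /= !mul0r subrr subr0.
rewrite big_nat_recr //= IH first_passage_probS iter_avoid_hitting -natr1 /=.
by ring.
Qed.

Lemma iter_avoid_le (f : G -> R) rho n i : 0 <= rho ->
  (forall k, avoid P j f k <= rho * f k) ->
  iter n (avoid P j) f i <= rho ^+ n * f i.
Proof.
move=> rho0 frho; elim: n i => [|n IH] i; first by rewrite mul1r.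
rewrite iterS; apply: le_trans (ler_avoid P_ge0 _ _ IH) _.
by rewrite avoidZ exprSr -mulrA ler_wpM2l // exprn_ge0.
Qed.

Lemma iter_avoid_mono (f g : G -> R) n i : (forall k, f k <= g k) ->
  iter n (avoid P j) f i <= iter n (avoid P j) g i.
Proof.
by move=> fg; elim: n i => [//|n IH] i; rewrite !iterS; apply: ler_avoid.
Qed.

Lemma iter_avoid_ge0 (f : G -> R) n i : (forall k, 0 <= f k) ->
  0 <= iter n (avoid P j) f i.
Proof.
move=> f0; elim: n i => [//|n IH] i.
by rewrite iterS sumr_ge0 // => k _; rewrite mulr_ge0.
Qed.

(** The first-step equation makes [h] superharmonic, hence nonnegative; inserting this in the
    equation gives the bound. *)
Lemma hitting_ge1 i : 1 <= h i.
Proof.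
have h0 k : 0 <= h k.
  apply: (avoid_superharmonic_ge0 P_ge0 P_sum1 P_irr (j := j)) => l.
  by rewrite [leRHS]hE lerDr.
by rewrite hE lerDl sumr_ge0 // => k _; rewrite mulr_ge0.
Qed.

(* If [c] bounds [h], then [avoid j h = h - 1 <= (1 - 1/c) h], hence a
   geometric decay of the survival probabilities. *)
Lemma mean_first_passageE i : mean_first_passage i j = (h i)%:E.
Proof.
pose c := \sum_k h k.
have h0 k : 0 <= h k by apply: le_trans (hitting_ge1 k).
have hc k : h k <= c by rewrite /c (bigD1 k) //= lerDl sumr_ge0.
have c1 : 1 <= c by apply: le_trans (hitting_ge1 i) (hc i).
have c0 : 0 < c by apply: lt_le_trans c1.
pose rho := 1 - c^-1.
have rho0 : 0 <= rho by rewrite subr_ge0 invf_le1.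
have rho1 : rho < 1 by rewrite gtrBl invr_gt0.
have hrho k : avoid P j h k <= rho * h k.
  have -> : avoid P j h k = h k - 1 by rewrite (hE k) addrC addKr.
  by rewrite mulrBl mul1r lerB // mulrC ler_pdivrMr // mul1r.
have lim0 : (iter n (avoid P j) h i @[n --> \oo] --> (0 : R))%classic.
  have l : (h i * rho ^+ n @[n --> \oo] --> (0 : R))%classic.
    by apply: cvg_geometric; rewrite ger0_norm.
  apply: (squeeze_cvgr _ (cvg_cst (0 : R)) l); apply: nearW => n.
  by rewrite iter_avoid_ge0 //= mulrC iter_avoid_le.
(* Since 1 is at most [h], survival probabilities inherit the geometric bound, which beats the
   factor [n]. *)
have lim1 : (n%:R * iter n (avoid P j) (fun=> 1) i @[n --> \oo] --> (0 : R))%classic.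
  have l : (h i * (n%:R * rho ^+ n) @[n --> \oo] --> (0 : R))%classic.
    rewrite -[X in (_ --> X)%classic](mulr0 (h i)); apply: cvgMr.
    exact: cvg_natmul_expr.
  apply: (squeeze_cvgr _ (cvg_cst (0 : R)) l); apply: nearW => n.
  rewrite mulr_ge0 ?iter_avoid_ge0 //= mulrCA ler_wpM2l // mulrC.
  apply: le_trans (iter_avoid_le _ _ rho0 hrho).
  by apply: iter_avoid_mono; exact: hitting_ge1.
have lim : (h i - iter n (avoid P j) h i - n%:R * iter n (avoid P j) (fun=> 1) i
    @[n --> \oo] --> h i)%classic.
  rewrite -[X in (_ --> X)%classic](subr0 (h i)) -[X in (_ --> X)%classic]subr0.
  by apply: cvgB => //; apply: cvgB => //; exact: cvg_cst.
apply: cvg_lim => //; under eq_fun do rewrite sumEFin.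
apply: cvg_EFin; first by apply: nearW.
rewrite -(cvg_shiftS (fun n => \sum_(0 <= t < n) t%:R * first_passage_prob i j t)).
by under eq_fun do rewrite partial_mean_first_passage.
Qed.

End MeanFirstPassage.

Lemma stationary_eq (p : {ffun G -> R}) : is_stationary p -> stationary G = p.
Proof.
move=> pP; apply: xget_unique => // q [q0 qP q1]; case: pP => [p0 pP p1].
by apply/ffunP; apply: (invariant_unique P_ge0 P_irr).
Qed.

(** The vertex [i0] witnesses that the state space is nonempty. *)
Lemma stationaryP (i0 : G) : is_stationary (stationary G).
Proof.
have [|p [p0 pP p1]] := ex_invariant P_ge0 P_sum1 P_irr; first by exists i0.
have pS : is_stationary [ffun i => p i].
  split=> [j|j|]; first by rewrite ffunE.
    by rewrite ffunE -[RHS]pP; apply: eq_bigr => i _; rewrite ffunE.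
  by rewrite -p1; apply: eq_bigr => i _; rewrite ffunE.
by rewrite (stationary_eq pS).
Qed.

(** Kac's formula: averaging the first-step equation against [p] makes all terms off [j] cancel. *)
Lemma stationary_mean_return (p h : G -> R) j : invariant P p ->
  \sum_i p i = 1 -> (forall i, h i = 1 + avoid P j h i) -> p j * h j = 1.
Proof.
move=> pP p1 hE.
have : \sum_i p i * h i = 1 + \sum_(k | k != j) p k * h k.
  under eq_bigr do rewrite hE mulrDr mulr1.
  rewrite big_split /= p1; congr (_ + _).
  under eq_bigr do rewrite mulr_sumr.
  rewrite exchange_big /=; apply: eq_bigr => k _.
  by rewrite -(pP k) mulr_suml; apply: eq_bigr => i _; rewrite mulrA.
by rewrite (bigD1 j) //= => /addIr.
Qed.

Lemma kemeny_fundamental_trace (i0 : G) :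
  exists2 Z, (1%:M - fun_mx P + const_mx 1 *m fun_row (stationary G)) *m Z = 1%:M
    & forall i : G, kemeny i = (\tr Z - 1)%:E.
Proof.
have [p0 pP p1] := stationaryP i0; set p := stationary G in p0 pP p1 *.
have /choice[h hE] := ex_mean_hitting P_ge0 P_sum1 P_irr.
(* [h j i] is the mean time from [i] to [j], so row [i] of [x] sums to Kemeny's constant from
   [i]. *)
pose x i j := if i == j then 0 else h j i * p j.
have Px i j : \sum_k P i k * x k j = (h j i - 1) * p j.
  rewrite (bigD1 j) //= /x eqxx mulr0 add0r hE [1 + _]addrC addrK mulr_suml.
  by apply: eq_bigr => k /negPf ->; rewrite mulrA.
have [||||Z ZE XE] := @fundamental_matrix_trace R _ (fun_mx P) (fun_mx x)
    (fun_row p) (const_mx 1).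
- rewrite mulmxBl mul1mx fun_mx_mul; apply/matrixP => i j.
  rewrite !mxE big_ord1 !mxE Px mul1r /x (inj_eq enum_val_inj).
  have [<-|_] := eqVneq i j; last by rewrite subr0; ring.
  (* On the diagonal, Kac's formula supplies the -1 of the identity matrix. *)
  by rewrite mulrBl mulrC (stationary_mean_return pP p1 (hE _)) mulr1n; ring.
- exact: fun_mx_const1.
- by rewrite fun_row_const1 p1.
- by move=> i; rewrite mxE /x eqxx.
exists Z => // i.
have := congr1 (fun M : 'cV_ _ => M (enum_rank i) 0) XE.
rewrite !mxE mulr1 => <-; rewrite /kemeny.
under eq_bigr do rewrite (mean_first_passageE (hE _)) -EFinM.
rewrite sumEFin; congr _%:E.
under [RHS]eq_bigr do rewrite !mxE mulr1 enum_rankK.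
rewrite [RHS](big_enum_ord _ (x i)) [LHS]big_mkcond /=.
by apply: eq_bigr => j _; rewrite /x [i == j]eq_sym; case: eqP.
Qed.

End KemenyTrace.

(** * Factorization of both walks through vertices and bicliques *)

Section BicliqueFactorization.
Variables (R : realType) (V : finType) (E : rel V).
Variable eps : {set {set V} * {set V}}.
Hypothesis Gconn : strongly_connected E.
Hypothesis Gedge : exists x y, E x y.
Hypothesis Geps : biclique_partition E eps.

Local Notation G := (unweighted R E).
Local Notation Theta := (biclique_digraph R E eps).

Lemma ex_out_edge u : exists v, E u v.
Proof.
have [x [y Exy]] := Gedge; have /connectP[[|v p] /= pth xE] := Gconn u x.
  by exists y; rewrite -xE.
by case/andP: pth => Euv _; exists v.
Qed.

Lemma ex_in_edge v : exists u, E u v.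
Proof.
have [x [y Exy]] := Gedge; have /connectP[p pth vE] := Gconn y v.
case: (lastP p) pth vE => [_ /= ->|s z]; first by exists x.
by rewrite rcons_path last_rcons => /andP[_ h] ->; exists (last y s).
Qed.

Lemma partition_edge u v : E u v ->
  exists Q : Theta, u \in (val Q).1 /\ v \in (val Q).2.
Proof.
move=> Euv; have [Q [[Qeps uQ vQ] _]] := Geps.2 u v Euv.
by exists (exist _ Q Qeps).
Qed.

(** The partition property as an identity of indicators, usable under sums. *)
Lemma sum_bicliques (u v : V) :
  \sum_(Q : Theta) (u \in (val Q).1)%:R * (v \in (val Q).2)%:R = (E u v)%:R :> R.
Proof.
have [Euv|nEuv] := boolP (E u v); last first.
  apply: big1 => Q _; have [_ QE] := Geps.1 _ (valP Q).
  case: (boolP (u \in _)) => uQ; last by rewrite mul0r.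
  case: (boolP (v \in _)) => vQ; last by rewrite mulr0.
  by rewrite QE in nEuv.
have [Q0 [[Qeps uQ vQ] Quniq]] := Geps.2 u v Euv.
rewrite (bigD1 (exist _ Q0 Qeps : Theta)) //= uQ vQ mulr1 big1 ?addr0 // => Q QQ0.
case: (boolP (u \in _)) => uQ'; last by rewrite mul0r.
case: (boolP (v \in _)) => vQ'; last by rewrite mulr0.
case/negP: QQ0; apply/eqP/val_inj => /=; apply/esym/Quniq.
by split=> //; exact: valP.
Qed.

Lemma card_head_gt0 (Q : Theta) : 0 < #|(val Q).2|%:R :> R.
Proof.
by have [[_ Q2 _] _] := Geps.1 _ (valP Q); rewrite ltr0n card_gt0.
Qed.

Lemma outdeg_gt0 u : 0 < (outdeg E u)%:R :> R.
Proof.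
have [v Euv] := ex_out_edge u; rewrite ltr0n card_gt0.
by apply/set0Pn; exists v; rewrite inE.
Qed.

Lemma outdegE u : (outdeg E u)%:R = \sum_v (E u v)%:R :> R.
Proof.
rewrite /outdeg cardsE -sum1_card natr_sum big_mkcond /=.
by apply: eq_bigr => v _; rewrite unfold_in; case: (E u v).
Qed.

Lemma cardE_sum (A : {set V}) : #|A|%:R = \sum_v (v \in A)%:R :> R.
Proof.
by rewrite -sum1_card natr_sum big_mkcond; apply: eq_bigr => v _; case: (v \in A).
Qed.

(** The proportion of the out-edges of [u] that belong to [Q]. *)
Definition tail_to_biclique (u : G) (Q : Theta) : R :=
  (u \in (val Q).1)%:R * #|(val Q).2|%:R / (outdeg E u)%:R.

Definition biclique_to_head (Q : Theta) (v : G) : R :=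
  (v \in (val Q).2)%:R / #|(val Q).2|%:R.

Local Notation U := tail_to_biclique.
Local Notation W := biclique_to_head.

Lemma tail_to_biclique_ge0 u Q : 0 <= U u Q.
Proof. by rewrite !mulr_ge0 // invr_ge0. Qed.

Lemma biclique_to_head_ge0 Q v : 0 <= W Q v.
Proof. by rewrite mulr_ge0 // invr_ge0. Qed.

(** Counts the out-edges of [u] biclique by biclique. *)
Lemma sum_tails u :
  \sum_(Q : Theta) (u \in (val Q).1)%:R * #|(val Q).2|%:R = (outdeg E u)%:R :> R.
Proof.
under eq_bigr do rewrite cardE_sum mulr_sumr.
by rewrite exchange_big outdegE; apply: eq_bigr => v _; rewrite sum_bicliques.
Qed.

Lemma tail_to_biclique_sum1 u : \sum_Q U u Q = 1.
Proof. by rewrite -mulr_suml sum_tails divff // gt_eqF ?outdeg_gt0. Qed.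

Lemma biclique_to_head_sum1 Q : \sum_v W Q v = 1.
Proof. by rewrite -mulr_suml -cardE_sum divff // gt_eqF ?card_head_gt0. Qed.

Lemma trans_prob_unweighted (u v : G) :
  trans_prob u v = \sum_Q U u Q * W Q v.
Proof.
transitivity ((E u v)%:R / (outdeg E u)%:R : R).
  rewrite /trans_prob /wdeg /= outdegE.
  have -> : \sum_(j | E u j) 1 = \sum_v (E u v)%:R :> R.
    by rewrite big_mkcond; apply: eq_bigr => j _; case: (E u j).
  by case: (E u v); rewrite ?mul0r.
rewrite -sum_bicliques mulr_suml; apply: eq_bigr => Q _; rewrite /U /W.
by field; rewrite !gt_eqF ?card_head_gt0 ?outdeg_gt0.
Qed.

(** After exchanging sums, each head [u] of [Q] contributes 1 by [sum_tails]. *)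
Lemma wdeg_bicliques (Q : Theta) : wdeg Q = #|(val Q).2|%:R.
Proof.
rewrite /wdeg /= big_mkcond /=.
transitivity (\sum_(Q' : Theta) \sum_(u in (val Q).2)
    (u \in (val Q').1)%:R * #|(val Q').2|%:R / (outdeg E u)%:R : R).
  apply: eq_bigr => Q' _; case: ifPn => [_|/negPn/eqP QQ'].
    rewrite mulr_sumr big_mkcond [RHS]big_mkcond; apply: eq_bigr => u _.
    by rewrite inE; case: (u \in _) => //=; case: (u \in _); rewrite ?mul1r ?mul0r.
  rewrite big1 // => u uQ; suff /negPf -> : u \notin (val Q').1 by rewrite !mul0r.
  by apply/negP => uQ'; have := finset.in_set0 u; rewrite -QQ' inE uQ uQ'.
rewrite exchange_big /= -sum1_card natr_sum; apply: eq_bigr => u _.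
by rewrite -mulr_suml sum_tails divff // gt_eqF ?outdeg_gt0.
Qed.

Lemma trans_prob_bicliques (Q Q' : Theta) :
  trans_prob Q Q' = \sum_u W Q u * U u Q'.
Proof.
rewrite /trans_prob wdeg_bicliques.
transitivity (weight Q Q' / #|(val Q).2|%:R : R).
  (* Without an edge the intersection is empty and the weight formula gives 0 anyway. *)
  case: ifPn => // /negPn/eqP QQ'.
  by rewrite [weight _ _]/= QQ' big_set0 mulr0 mul0r.
rewrite [weight _ _]/= mulr_sumr mulr_suml big_mkcond; apply: eq_bigr => u _.
rewrite inE /U /W; case: (u \in _); case: (u \in _); rewrite /= ?mul0r ?mulr0 //.
by rewrite !mul1r mulrC mulrA.
Qed.

Lemma trans_prob_unweighted_ge0 (u v : G) : 0 <= trans_prob u v.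
Proof.
rewrite trans_prob_unweighted sumr_ge0 // => Q _.
by rewrite mulr_ge0 ?tail_to_biclique_ge0 ?biclique_to_head_ge0.
Qed.

Lemma trans_prob_bicliques_ge0 (Q Q' : Theta) : 0 <= trans_prob Q Q'.
Proof.
rewrite trans_prob_bicliques sumr_ge0 // => u _.
by rewrite mulr_ge0 ?tail_to_biclique_ge0 ?biclique_to_head_ge0.
Qed.

Lemma trans_prob_unweighted_sum1 (u : G) : \sum_v trans_prob u v = 1.
Proof.
under eq_bigr do rewrite trans_prob_unweighted; rewrite exchange_big /=.
under eq_bigr do rewrite -mulr_sumr biclique_to_head_sum1 mulr1.
exact: tail_to_biclique_sum1.
Qed.

Lemma trans_prob_bicliques_sum1 (Q : Theta) : \sum_Q' trans_prob Q Q' = 1.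
Proof.
under eq_bigr do rewrite trans_prob_bicliques; rewrite exchange_big /=.
under eq_bigr do rewrite -mulr_sumr tail_to_biclique_sum1 mulr1.
exact: biclique_to_head_sum1.
Qed.

Lemma unweighted_irreducible (u v : G) :
  connect (fun x y : G => 0 < trans_prob x y) u v.
Proof.
apply: connect_sub (Gconn u v) => x y Exy; apply: connect1.
rewrite /trans_prob /= Exy mul1r invr_gt0 /wdeg /= (bigD1 y) //=.
by rewrite ltr_pwDl ?sumr_ge0.
Qed.

Lemma trans_prob_bicliques_gt0 (Q Q' : Theta) v :
  v \in (val Q).2 -> v \in (val Q').1 -> 0 < trans_prob Q Q'.
Proof.
move=> vQ vQ'; rewrite trans_prob_bicliques (bigD1 v) //= ltr_pwDl //.
  rewrite /U /W vQ vQ' !mul1r.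
  by rewrite !(mulr_gt0, invr_gt0) ?card_head_gt0 ?outdeg_gt0.
rewrite sumr_ge0 // => u _.
by rewrite mulr_ge0 ?tail_to_biclique_ge0 ?biclique_to_head_ge0.
Qed.

(** A path in [G] from a head of [Q] to a tail of [Q'] lifts to [Theta]: bicliques of consecutive
    edges share the middle vertex. *)
Lemma bicliques_irreducible (Q Q' : Theta) :
  connect (fun x y : Theta => 0 < trans_prob x y) Q Q'.
Proof.
have [[_ /set0Pn[v vQ] _] _] := Geps.1 _ (valP Q).
have [[/set0Pn[u uQ'] _ _] _] := Geps.1 _ (valP Q').
have /connectP[p pth uE] := Gconn v u; rewrite {}uE in uQ'.
elim: p v Q vQ pth uQ' => [|w p IH] v Q vQ /=.
  by move=> _ vQ'; apply/connect1/(trans_prob_bicliques_gt0 vQ).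
move=> /andP[Evw pth] uQ'; have [Q1 [vQ1 wQ1]] := partition_edge Evw.
apply: connect_trans (IH w Q1 wQ1 pth uQ').
exact/connect1/(trans_prob_bicliques_gt0 vQ).
Qed.

(** Invariance is the reassociation (pi W)(U W) = (pi (W U)) W = pi W; uniqueness concludes. *)
Lemma stationary_unweighted (Q0 : Theta) (u : G) :
  stationary G u = \sum_Q stationary Theta Q * W Q u.
Proof.
have [s0 sP s1] := stationaryP trans_prob_bicliques_ge0
  trans_prob_bicliques_sum1 bicliques_irreducible Q0.
suff pS : is_stationary [ffun v : G => \sum_Q stationary Theta Q * W Q v].
  rewrite (stationary_eq trans_prob_unweighted_ge0 unweighted_irreducible pS).
  by rewrite ffunE.
split=> [v|v|].
(* An edge into [v] lies in a biclique having [v] as a head, which gives a positive summand. *)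
- rewrite ffunE; have [w Ewv] := ex_in_edge v.
  have [Q [_ vQ]] := partition_edge Ewv.
  rewrite (bigD1 Q) //= ltr_pwDl //.
    by rewrite mulr_gt0 // /W vQ mul1r invr_gt0 card_head_gt0.
  by rewrite sumr_ge0 // => Q' _; rewrite mulr_ge0 ?biclique_to_head_ge0 ?ltW.
- rewrite ffunE.
  under eq_bigr do rewrite ffunE mulr_suml.
  rewrite exchange_big /=.
  under eq_bigr => Q _.
    under eq_bigr do rewrite trans_prob_unweighted -mulrA mulr_sumr.
    rewrite -mulr_sumr exchange_big /=.
    under eq_bigr do [under eq_bigr do rewrite mulrA;
      rewrite -mulr_suml -trans_prob_bicliques].
    rewrite mulr_sumr.
    over.
  rewrite exchange_big /=; apply: eq_bigr => Q _.
  by rewrite -sP mulr_suml; apply: eq_bigr => Q' _; rewrite mulrA.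
- under eq_bigr do rewrite ffunE.
  rewrite exchange_big -s1; apply: eq_bigr => Q _.
  by rewrite -mulr_sumr biclique_to_head_sum1 mulr1.
Qed.

End BicliqueFactorization.

Theorem theorem4p1 (R : realType) (V : finType) (E : rel V)
    (eps : {set {set V} * {set V}})
    (Gconn : strongly_connected E)
    (Gedge : exists x y, E x y)
    (Geps : biclique_partition E eps) :
  let G := unweighted R E in
  let Theta := biclique_digraph R E eps in
  (forall u : G,
     stationary G u =
       \sum_(Q : Theta | u \in (val Q).2)
         #|(val Q).2|%:R^-1 * stationary Theta Q) /\
  (forall (i : G) (k : Theta),
     kemeny i = (kemeny k + #|V|%:R%:E - #|eps|%:R%:E)%E).
Proof.
move=> G Theta; split=> [u|i k].
  have [x [y /(partition_edge R Geps)[Q0 _]]] := Gedge.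
  rewrite (stationary_unweighted Gconn Gedge Geps Q0) [RHS]big_mkcond /=.
  apply: eq_bigr => Q _; rewrite /biclique_to_head.
  by case: (u \in _); rewrite ?mul0r ?mulr0 // mul1r mulrC.
have [Y YE ->] := kemeny_fundamental_trace
  (trans_prob_unweighted_ge0 Gconn Gedge Geps)
  (trans_prob_unweighted_sum1 Gconn Gedge Geps)
  (@unweighted_irreducible R _ _ Gconn) i.
have [Z ZE ->] := kemeny_fundamental_trace
  (trans_prob_bicliques_ge0 Gconn Gedge Geps)
  (trans_prob_bicliques_sum1 Gconn Gedge Geps)
  (bicliques_irreducible Gconn Gedge Geps) k.
set U : 'M[R]_(#|G|, #|Theta|) := fun_mx (@tail_to_biclique R V E eps).
set W : 'M[R]_(#|Theta|, #|G|) := fun_mx (@biclique_to_head R V E eps).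
set s := fun_row (stationary Theta) in ZE.
have PG : fun_mx (@trans_prob R G) = U *m W.
  by rewrite fun_mx_mul; apply: eq_fun_mx => u v; exact: trans_prob_unweighted.
have PT : fun_mx (@trans_prob R Theta) = W *m U.
  by rewrite fun_mx_mul; apply: eq_fun_mx => Q Q'; exact: trans_prob_bicliques.
have sG : fun_row (stationary G) = s *m W.
  rewrite fun_row_mul; apply/rowP => j; rewrite !mxE.
  exact: stationary_unweighted.
have W1 : W *m const_mx 1 = const_mx 1 :> 'cV_ _.
  by apply: fun_mx_const1 => Q; exact: biclique_to_head_sum1.
have YE' : (1%:M - (U - const_mx 1 *m s) *m W) *m Y = 1%:M.
  rewrite -[RHS]YE PG sG; congr (_ *m Y).
  by rewrite mulmxBl opprB addrCA addrC mulmxA.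
(* As [W] fixes the all-ones column, the rank-one correction passes through [W] to become that of
   [Theta]. *)
have ZE' : (1%:M - W *m (U - const_mx 1 *m s)) *m Z = 1%:M.
  rewrite -[RHS]ZE PT; congr (_ *m Z).
  by rewrite mulmxBr mulmxA W1 opprB addrCA addrC.
rewrite (mxtrace_inv_1B_mulC YE' ZE') -!EFinD; congr _%:E.
have -> : #|eps| = #|Theta| by rewrite /= card_sig.
by ring.
Qed.
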